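(* Let $S$ be a ring and $R$ a subring of $S$ contained in the center of $S$. Assume that $S$ is additively generated by its invertible elements. Let $M$ be a free $S$-module of finite rank, and put $G=\operatorname{Aut}(_RM)$, $G_0=\operatorname{Aut}(_SM)\leqslant G$. Let $G'$ be a subgroup of $G$ and put $G_0'=G_0\cap G'$. Assume that $G_0'$ additively generates the group $G_0$ over $R$, i.e. every element of $G_0$ is a finite sum $\sum_i\alpha_i t_i$ with $\alpha_i\in R$ and $t_i\in G_0'$. Then the normalizer of $G_0'$ in $G'$ is equal to the intersection with $G'$ of the semidirect product of the normal subgroup $G_0$ and a subgroup isomorphic to the group $\operatorname{Aut}(S/R)$ of all ring automorphisms of $S$ that are identical on $R$.
   Context: Rings are associative with unit, subrings are unitary, modules are left modules. $\operatorname{Aut}(_RM)$ and $\operatorname{Aut}(_SM)$ are the groups of $R$-linear and $S$-linear automorphisms of $M$. The semidirect product is a subgroup of $G$. The sums $\sum_i\alpha_it_i$ are taken in $\operatorname{End}(_SM)$, which is an $R$-module since $R$ is contained in the center of $S$.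
   Formalization: The rank of M is assumed positive: for M = 0 of rank 0 the group G is trivial while Aut(S/R) need not be (e.g. S = Z[i], R = Z), so the claim fails there. *)

(* Defs.v *)
From HB Require Import structures.
From mathcomp Require Import all_boot all_order all_algebra all_fingroup.
From mathcomp Require Import all_classical.

Set Implicit Arguments.
Unset Strict Implicit.
Unset Printing Implicit Defensive.

Import GRing.Theory.
Local Open Scope classical_set_scope.
Local Open Scope ring_scope.

(* The group of all bijections T -> T, with (f * g) x = f (g x).  All the     *)
(* automorphism groups below are subgroups of such groups; a subgroup is a    *)
(* set of elements of the ambient group.                                      *)

Record symType (T : Type) := Sym {
  sym_fun :> T -> T;
  sym_bij : bijective sym_fun }.

Section SymGroup.
Variable T : Type.
Implicit Types f g : symType T.

HB.instance Definition _ := gen_eqMixin (symType T).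
HB.instance Definition _ := gen_choiceMixin (symType T).

Lemma sym_ext f g : sym_fun f =1 sym_fun g -> f = g.
Proof.
case: f g => [f fb] [g gb] /= /funext fg; case: g / fg gb => gb.
by congr Sym; exact: Prop_irrelevance.
Qed.

Lemma sym_inv_exists f : exists g : T -> T, cancel f g /\ cancel g f.
Proof. by case: (sym_bij f) => g fK gK; exists g. Qed.

Definition sym_inv_fun f : T -> T := projT1 (cid (sym_inv_exists f)).

Lemma sym_funK f : cancel f (sym_inv_fun f).
Proof. by rewrite /sym_inv_fun; case: cid => g []. Qed.

Lemma sym_inv_funK f : cancel (sym_inv_fun f) f.
Proof. by rewrite /sym_inv_fun; case: cid => g []. Qed.

Definition sym_one : symType T := Sym (Bijective (frefl id) (frefl id)).

Definition sym_mul f g : symType T := Sym (bij_comp (sym_bij f) (sym_bij g)).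

Definition sym_inv f : symType T :=
  Sym (Bijective (sym_inv_funK f) (sym_funK f)).

Fact sym_mulA : associative sym_mul.
Proof. by move=> f g h; apply: sym_ext. Qed.

Fact sym_mul1 : left_id sym_one sym_mul.
Proof. by move=> f; apply: sym_ext. Qed.

Fact sym_mulr1 : right_id sym_one sym_mul.
Proof. by move=> f; apply: sym_ext. Qed.

Fact sym_mulV : left_inverse sym_one sym_inv sym_mul.
Proof. by move=> f; apply: sym_ext => x; exact: sym_funK. Qed.

Fact sym_mulrV : right_inverse sym_one sym_inv sym_mul.
Proof. by move=> f; apply: sym_ext => x; exact: sym_inv_funK. Qed.

HB.instance Definition _ :=
  isGroup.Build (symType T) sym_mulA sym_mul1 sym_mulr1 sym_mulV sym_mulrV.

End SymGroup.

Section Groups.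
Variable gT : groupType.
Implicit Types H K N P : set gT.

Definition is_subgroup H : Prop := group_closed [in H].

Definition normalizer H K : set gT :=
  [set g | H g /\ (fun x => (x ^ g)%g) @` K = K].

Definition is_normal N P : Prop :=
  [/\ is_subgroup N, N `<=` P & P `<=` normalizer P N].

Definition is_semidirect_product P N K : Prop :=
  [/\ is_subgroup P, is_normal N P, is_subgroup K /\ K `<=` P,
      N `&` K = [set 1%g] & P = [set (x * y)%g | x in N & y in K]].

End Groups.

Definition isomorphic_subgroups (gT hT : groupType)
    (H : set gT) (K : set hT) : Prop :=
  exists phi : gT -> hT,
    set_bij H K phi /\ {in H &, {morph phi : x y / (x * y)%g}}.

Section Rings.
Variable S : pzRingType.

(* [GRing.unit] would require [S] to be nontrivial with decidable units.      *)
Definition invertible (x : S) : Prop := exists y, x * y = 1 /\ y * x = 1.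

Definition additively_generated_by_units : Prop :=
  forall x : S, exists (k : nat) (u : 'I_k -> S) (c : 'I_k -> int),
    (forall i, invertible (u i)) /\ x = \sum_(i < k) u i *~ c i.

Definition ring_aut_over (R : set S) : set (symType S) :=
  [set s | [/\ {morph s : x y / x + y}, GRing.monoid_morphism s
             & forall r, R r -> s r = r]].

Variable M : lmodType S.

Definition is_basis (n : nat) (e : 'I_n -> M) : Prop :=
  forall m : M, exists! c : {ffun 'I_n -> S}, m = \sum_(i < n) c i *: e i.

Definition free_of_rank (n : nat) : Prop := exists e : 'I_n -> M, is_basis e.

(* [linear_aut setT] is the group of S-linear automorphisms. *)
Definition linear_aut (R : set S) : set (symType M) :=
  [set f | {morph f : x y / x + y}
           /\ forall r, R r -> {morph f : x / r *: x}].

Definition additively_generates_over (R : set S) (H K : set (symType M)) :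
    Prop :=
  forall g, K g -> exists (k : nat) (a : 'I_k -> S) (t : 'I_k -> symType M),
    (forall i, R (a i) /\ H (t i))
    /\ forall m : M, g m = \sum_(i < k) a i *: t i m.

End Rings.
Arguments linear_aut {S} M R.

(* Main.v *)
Require Import Defs.
From HB Require Import structures.
From mathcomp Require Import all_boot all_order all_algebra all_fingroup.
From mathcomp Require Import all_classical.

Set Implicit Arguments.
Unset Strict Implicit.
Unset Printing Implicit Defensive.

Import GRing.Theory.
Local Open Scope classical_set_scope.
Local Open Scope ring_scope.

(** The group [P] consists of the automorphisms [g] of [M] that are
    semilinear along some [s] in Aut(S/R), i.e. [g (a *: m) = s a *: g m].
    Once a basis [e] is chosen, applying [s] to all coordinates gives a copy
    [A] of Aut(S/R) inside [P] which splits the map sending [g] to its [s], and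
    the kernel of that map is [G0]; hence [P] is the semidirect product of
    [G0] and [A] ([semilinear_semidirect]).  In particular [P] normalizes
    [G0], and an element of [P] lying in [G'] also normalizes [G0' = G0 & G'].

    Conversely, let [g] in [G'] normalize [G0'].  Conjugation by [g] is
    R-linear and preserves [G0'], so it preserves the R-span of [G0'] in
    End(M); that span contains [G0] and consists of S-linear maps because [R]
    is central.  So [g] normalizes [G0] ([conj_span_linear]).

    For a scalar [a], the homothety by [a] commutes with [G0], so its
    conjugate by [g] commutes with [G0] too.  It remains to see that an
    additive map commuting with [G0] is a homothety ([commutant_scalar]); then
    [g o a o g^-1] is the homothety by some [s a], which says that [g] is
    semilinear along [s], and [s] is invertible because [g^-1] can be treated
    in the same way ([normalizing_semilinear]).  Maps commuting with [G0]
    also commute with the elementary maps sending [m] to [m_i * a *: e_j]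
    ([commutes_elem_map]): off the diagonal these are transvections minus the
    identity, on the diagonal they are composites of two off-diagonal ones,
    except in rank one, where [S] being generated by its units makes them
    sums and differences of right multiplications by units.  Commuting with
    these maps forces a map to act on every [a *: e_j] as one and the same
    homothety. *)

(** * Subgroups, conjugation and images *)

Section Subgroups.
Variable gT : groupType.
Implicit Types (H K : set gT) (g x y : gT).

Lemma is_subgroupP H :
  is_subgroup H <-> H 1%g /\ (forall x y, H x -> H y -> H (x * y^-1)%g).
Proof.
split=> [[H1 Hdiv]|[H1 Hdiv]]; split; rewrite ?unfold_in ?in_setE //.
- by move: H1; rewrite unfold_in in_setE.
- move=> x y Hx Hy; have := Hdiv x y; rewrite !unfold_in !in_setE; exact.
- by move=> x y; rewrite !unfold_in !in_setE; exact: Hdiv.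
Qed.

Lemma subgroup1 H : is_subgroup H -> H 1%g.
Proof. by case/is_subgroupP. Qed.

Lemma subgroupV H x : is_subgroup H -> H x -> H x^-1%g.
Proof.
by case/is_subgroupP=> H1 Hdiv Hx; rewrite -[x^-1%g]mul1g; exact: Hdiv.
Qed.

Lemma subgroupM H x y : is_subgroup H -> H x -> H y -> H (x * y)%g.
Proof.
move=> sgH Hx Hy; rewrite -[y]invgK; case/is_subgroupP: (sgH) => _ Hdiv.
by apply: Hdiv => //; exact: subgroupV.
Qed.

Lemma subgroupJ H x g : is_subgroup H -> H x -> H g -> H (x ^ g)%g.
Proof.
move=> sgH Hx Hg; rewrite conjgE.
by apply: subgroupM => //; [exact: subgroupV | exact: subgroupM].
Qed.

Lemma subgroupI H K : is_subgroup H -> is_subgroup K -> is_subgroup (H `&` K).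
Proof.
move=> /is_subgroupP[H1 Hdiv] /is_subgroupP[K1 Kdiv]; apply/is_subgroupP.
by split=> // x y [Hx Kx] [Hy Ky]; split; [exact: Hdiv | exact: Kdiv].
Qed.

(** The condition defining the normalizer is an equality of sets, not an
    inclusion: for infinite groups a conjugate of [K] can be a proper subset of
    [K], so stability under [g^-1] has to be asked separately. *)
Lemma conj_image_eq K g :
  (fun x => (x ^ g)%g) @` K = K <->
  (forall x, K x -> K (x ^ g)%g) /\ (forall x, K x -> K (x ^ g^-1)%g).
Proof.
split=> [Kg|[Kg KgV]].
  split=> x Kx; first by rewrite -Kg; exists x.
  by move: Kx; rewrite -{1}Kg => -[y Ky <-]; rewrite conjgK.
apply/seteqP; split=> [_ [x Kx <-]|x Kx]; first exact: Kg.
by exists (x ^ g^-1)%g; [exact: KgV | rewrite conjgKV].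
Qed.

End Subgroups.

Section InjectiveImage.
Variables (gT hT : groupType) (K : set gT) (psi : gT -> hT).
Hypotheses (psiM : {morph psi : x y / (x * y)%g}) (psi_inj : injective psi).

Lemma group_morph1 : psi 1%g = 1%g.
Proof. by apply: (mulgI (psi 1%g)); rewrite -psiM !mulg1. Qed.

Lemma group_morphV x : psi x^-1%g = (psi x)^-1%g.
Proof. by apply: (mulgI (psi x)); rewrite -psiM !mulgV group_morph1. Qed.

Lemma subgroup_image : is_subgroup K -> is_subgroup (psi @` K).
Proof.
move=> /is_subgroupP[K1 Kdiv]; apply/is_subgroupP; split.
  by exists 1%g => //; exact: group_morph1.
move=> _ _ [x Kx <-] [y Ky <-]; exists (x * y^-1)%g; first exact: Kdiv.
by rewrite psiM group_morphV.
Qed.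

(** The isomorphism must be given by a function on the whole ambient group
    [gT]; outside the range of [psi] the left inverse takes the junk
    value [1]. *)
Lemma image_isomorphic : isomorphic_subgroups (psi @` K) K.
Proof.
pose phi y := xget 1%g [set x | psi x = y].
have psiK : cancel psi phi.
  by move=> x; apply: xget_unique => //= y; exact: psi_inj.
exists phi; split; last first.
  move=> _ _ /set_mem[x _ <-] /set_mem[y _ <-].
  by rewrite -psiM !psiK.
split.
- by move=> _ [x Kx <-]; rewrite psiK.
- by move=> _ _ /set_mem[x _ <-] /set_mem[y _ <-]; rewrite !psiK => ->.
- by move=> x Kx; exists (psi x); [exists x | rewrite psiK].
Qed.

End InjectiveImage.

(** * Additive maps and bijections *)

Section AdditiveMaps.
Variables (U V : zmodType) (f : U -> V).
Hypothesis fD : {morph f : x y / x + y}.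

Lemma additive0 : f 0 = 0.
Proof. by apply: (@addrI _ (f 0)); rewrite -fD !addr0. Qed.

Lemma additiveN : {morph f : x / - x}.
Proof. by move=> x; apply: (@addrI _ (f x)); rewrite -fD !subrr additive0. Qed.

Lemma additive_sum (I : finType) (F : I -> U) :
  f (\sum_i F i) = \sum_i f (F i).
Proof. exact: (big_morph f fD additive0). Qed.

End AdditiveMaps.

Lemma symV_apply T (f : symType T) : cancel f (f^-1)%g.
Proof. exact: sym_funK. Qed.

Lemma symVK_apply T (f : symType T) : cancel (f^-1)%g f.
Proof. exact: sym_inv_funK. Qed.

Lemma symM_apply T (f g : symType T) x : (f * g)%g x = f (g x).
Proof. by []. Qed.

Lemma symJ_apply T (f g : symType T) x : (f ^ g)%g x = (g^-1)%g (f (g x)).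
Proof. by []. Qed.

Lemma symV_morph T (f : symType T) (op : T -> T -> T) :
  {morph f : x y / op x y} -> {morph (f^-1)%g : x y / op x y}.
Proof.
move=> fM x y; rewrite -{1}[x](symVK_apply f) -{1}[y](symVK_apply f) -fM.
exact: symV_apply.
Qed.

(** * Linear and semilinear automorphisms *)

Section Automorphisms.
Variables (S : pzRingType) (M : lmodType S).

Lemma linear_aut_subgroup (R : set S) : is_subgroup (linear_aut M R).
Proof.
apply/is_subgroupP; split=> [|f g [fD fZ] [gD gZ]]; first by split.
have gVD := symV_morph gD.
split=> [x y|r Rr x]; rewrite !symM_apply; first by rewrite gVD fD.
by rewrite -fZ // -{1}[x](symVK_apply g) -gZ // symV_apply.
Qed.

Lemma ring_aut_subgroup (R : set S) : is_subgroup (ring_aut_over R).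
Proof.
apply/is_subgroupP; split=> [|s t [sD [s1 sM] sR] [tD [t1 tM] tR]].
  by split.
split.
- by move=> x y; rewrite !symM_apply (symV_morph tD) sD.
- split=> [|x y]; rewrite !symM_apply.
    by rewrite -[X in (t^-1)%g X]t1 symV_apply.
  by rewrite (symV_morph tM) sM.
- by move=> r Rr; rewrite symM_apply -[X in (t^-1)%g X](tR _ Rr) symV_apply sR.
Qed.

Definition semilinear_aut (R : set S) : set (symType M) :=
  [set f | {morph f : x y / x + y}
           /\ exists2 s, ring_aut_over R s
              & forall a m, f (a *: m) = s a *: f m].

Lemma semilinear_aut_subgroup (R : set S) : is_subgroup (semilinear_aut R).
Proof.
apply/is_subgroupP; split=> [|f g [fD [s Rs fZ]] [gD [t Rt gZ]]].
  by split=> //; exists 1%g => //; exact: subgroup1 (ring_aut_subgroup R).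
split=> [x y|]; first by rewrite !symM_apply (symV_morph gD) fD.
exists (s * t^-1)%g.
  by have /is_subgroupP[_ ] := ring_aut_subgroup R; apply.
move=> a m; rewrite !symM_apply -fZ; congr (f _).
by rewrite -{1}[m](symVK_apply g) -{1}[a](symVK_apply t) -gZ symV_apply.
Qed.

Lemma linear_sub_semilinear (R : set S) :
  linear_aut M [set: S] `<=` semilinear_aut R.
Proof.
move=> f [fD fZ]; split=> //; exists 1%g; last by move=> a m; rewrite fZ.
exact: subgroup1 (ring_aut_subgroup R).
Qed.

Lemma semilinear_sub_linear (R : set S) : semilinear_aut R `<=` linear_aut M R.
Proof. by move=> f [fD [s [_ _ sR] fZ]]; split=> // r Rr m; rewrite fZ sR. Qed.

(** The twist introduced by [g] is undone by [g^-1], since [f] in between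
    commutes with all scalars. *)
Lemma linear_conj_semilinear (R : set S) f g :
  linear_aut M [set: S] f -> semilinear_aut R g ->
  linear_aut M [set: S] (f ^ g)%g.
Proof.
move=> [fD fZ] [gD [s _ gZ]]; split=> [x y|a _ x]; rewrite !symJ_apply.
  by rewrite gD fD (symV_morph gD).
by rewrite gZ fZ // -{1}[f _](symVK_apply g) -gZ symV_apply.
Qed.

Lemma linear_normal_semilinear (R : set S) :
  is_normal (linear_aut M [set: S]) (semilinear_aut R).
Proof.
split; [exact: linear_aut_subgroup | exact: linear_sub_semilinear |].
move=> g Pg; split=> //; apply/conj_image_eq; split=> f lf.
  exact: linear_conj_semilinear lf Pg.
by apply: linear_conj_semilinear lf _; apply: subgroupV Pg;
  exact: semilinear_aut_subgroup.
Qed.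

(** This is where the hypothesis that [G0'] spans [G0] over [R] enters: it
    upgrades stability of [H] under conjugation to stability of everything in
    the R-span of [H].  R-linearity of [g] moves the coefficients out of the
    conjugation, and their centrality makes the resulting sum S-linear. *)
Lemma conj_span_linear (R : set S) (H : set (symType M)) (f g : symType M) :
  (forall r s : S, R r -> GRing.comm r s) ->
  H `<=` linear_aut M [set: S] -> linear_aut M R g ->
  (forall t, H t -> H (t ^ g)%g) ->
  additively_generates_over R H [set f] ->
  linear_aut M [set: S] (f ^ g)%g.
Proof.
move=> Rcentral Hlin lg Hg /(_ f erefl) [k [a [t [aHt fE]]]].
have [gVD gVZ] := subgroupV (linear_aut_subgroup R) lg.
have fgE m : (f ^ g)%g m = \sum_(i < k) a i *: (t i ^ g)%g m.
  rewrite symJ_apply fE (additive_sum gVD).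
  by apply: eq_bigr => i _; rewrite gVZ //; have [] := aHt i.
have tglin i : linear_aut M [set: S] (t i ^ g)%g.
  by apply/Hlin/Hg; have [] := aHt i.
split=> [x y|b _ x]; rewrite !fgE.
  rewrite -big_split; apply: eq_bigr => i _ /=.
  by have [tD _] := tglin i; rewrite -scalerDr -tD.
rewrite scaler_sumr; apply: eq_bigr => i _.
have [_ ->//] := tglin i.
by rewrite !scalerA Rcentral //; have [] := aHt i.
Qed.

End Automorphisms.
Arguments semilinear_aut {S} M R.

(** * Coordinates and coordinatewise automorphisms *)

Section Basis.
Variables (S : pzRingType) (M : lmodType S) (n : nat) (e : 'I_n -> M).
Hypothesis e_basis : is_basis e.

Definition lincomb (c : {ffun 'I_n -> S}) : M := \sum_(i < n) c i *: e i.

Lemma coord_exists m : exists c, m = lincomb c.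
Proof. by have [c [mE _]] := e_basis m; exists c. Qed.

Definition coord m : {ffun 'I_n -> S} := projT1 (cid (coord_exists m)).

Lemma coordK : cancel coord lincomb.
Proof. by move=> m; rewrite /coord; case: cid. Qed.

Lemma lincombK : cancel lincomb coord.
Proof.
move=> c; have [d [_ dU]] := e_basis (lincomb c).
rewrite -[RHS](dU _ erefl); apply/esym/dU; exact/esym/coordK.
Qed.

Lemma coordD m m' i : coord (m + m') i = coord m i + coord m' i.
Proof.
suff -> : m + m' = lincomb [ffun j => coord m j + coord m' j].
  by rewrite lincombK ffunE.
rewrite -{1}[m]coordK -{1}[m']coordK /lincomb -big_split.
by apply: eq_bigr => j _ /=; rewrite ffunE scalerDl.
Qed.

Lemma coordZ a m i : coord (a *: m) i = a * coord m i.
Proof.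
suff -> : a *: m = lincomb [ffun j => a * coord m j].
  by rewrite lincombK ffunE.
rewrite -{1}[m]coordK /lincomb scaler_sumr.
by apply: eq_bigr => j _ /=; rewrite ffunE scalerA.
Qed.

Lemma coord_basis i j : coord (e i) j = (j == i)%:R.
Proof.
suff -> : e i = lincomb [ffun k => (k == i)%:R] by rewrite lincombK ffunE.
rewrite /lincomb (bigD1 i) //= ffunE eqxx scale1r big1 ?addr0 // => k kNi.
by rewrite ffunE (negbTE kNi) scale0r.
Qed.

(** With a basis vector at hand, an identity between scalars can be checked on
    its multiples; all identities for twists below are obtained this way. *)
Lemma scale_basis_inj i : injective (fun a => a *: e i).
Proof.
move=> a b /(congr1 (fun m => coord m i)).
by rewrite !coordZ coord_basis eqxx !mulr1.
Qed.

Definition coordwise_fun (s : S -> S) m := lincomb [ffun i => s (coord m i)].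

Lemma coordwise_funK s t :
  cancel s t -> cancel (coordwise_fun s) (coordwise_fun t).
Proof.
move=> sK m; rewrite /coordwise_fun lincombK -[RHS]coordK; congr lincomb.
by apply/ffunP=> i; rewrite !ffunE sK.
Qed.

Lemma coordwise_bij (s : symType S) : bijective (coordwise_fun s).
Proof.
exists (coordwise_fun (s^-1)%g); apply: coordwise_funK;
  [exact: symV_apply | exact: symVK_apply].
Qed.

Definition coordwise (s : symType S) : symType M := Defs.Sym (coordwise_bij s).

Lemma coordwiseM : {morph coordwise : s t / (s * t)%g}.
Proof.
move=> s t; apply: sym_ext => m /=; rewrite /coordwise_fun lincombK.
by congr lincomb; apply/ffunP=> i; rewrite !ffunE.
Qed.

Lemma coordwise_basis (s : symType S) a i :
  s 0 = 0 -> coordwise s (a *: e i) = s a *: e i.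
Proof.
move=> s0; rewrite /= /coordwise_fun /lincomb (bigD1 i) //= big1.
  by rewrite addr0 ffunE coordZ coord_basis eqxx mulr1.
move=> j jNi; rewrite ffunE coordZ coord_basis (negbTE jNi) mulr0 s0.
by rewrite scale0r.
Qed.

(** A basis vector is required: in rank zero every [coordwise s] is the identity
    of the zero module. *)
Lemma coordwise_inj : 'I_n -> injective coordwise.
Proof.
move=> i s t st; apply: sym_ext => a.
have := congr1 (fun f : symType M => coord (f (a *: e i)) i) st.
by rewrite /= /coordwise_fun !lincombK !ffunE coordZ coord_basis eqxx mulr1.
Qed.

Lemma coordwise_semilinearZ (R : set S) s :
  ring_aut_over R s -> forall a m, coordwise s (a *: m) = s a *: coordwise s m.
Proof.
move=> [_ [_ sM] _] a m; rewrite /= /coordwise_fun /lincomb scaler_sumr.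
by apply: eq_bigr => i _; rewrite !ffunE coordZ sM scalerA.
Qed.

Lemma coordwise_semilinear (R : set S) s :
  ring_aut_over R s -> semilinear_aut M R (coordwise s).
Proof.
move=> Rs; have [sD _ _] := Rs; split=> [x y|]; last first.
  by exists s => //; exact: coordwise_semilinearZ Rs.
rewrite /= /coordwise_fun /lincomb -big_split; apply: eq_bigr => i _ /=.
by rewrite !ffunE coordD sD scalerDl.
Qed.

(** If [f] and [coordwise s] have the same twist [s], then
    [f * (coordwise s)^-1] is S-linear, which gives the factorization.  The
    intersection is trivial because a linear [coordwise s] fixes [e i0], hence
    all its multiples [a *: e i0], so that [s a = a]. *)
Lemma semilinear_semidirect (R : set S) (i0 : 'I_n) :
  is_semidirect_product (semilinear_aut M R) (linear_aut M [set: S])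
    (coordwise @` ring_aut_over R).
Proof.
have sgP := semilinear_aut_subgroup M R.
split=> //; first exact: linear_normal_semilinear.
- split; last by move=> _ [s Rs <-]; exact: coordwise_semilinear.
  exact: subgroup_image coordwiseM (ring_aut_subgroup R).
- apply/seteqP; split=> [f [[fD fZ] [s [sD [s1 _] _] sE]]|_ ->]; last first.
    split; first exact: subgroup1 (linear_aut_subgroup M _).
    exists 1%g; first exact: subgroup1 (ring_aut_subgroup R).
    exact: (group_morph1 coordwiseM).
  rewrite /=; suff s_id : s = 1%g by rewrite -sE s_id (group_morph1 coordwiseM).
  apply: sym_ext => a; apply: (@scale_basis_inj i0) => /=.
  have s0 := additive0 sD.
  rewrite -coordwise_basis // sE fZ // -[X in _ *: _ X]scale1r -sE.
  by rewrite coordwise_basis // s1 scale1r.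
- apply/seteqP; split=> [f Pf|_ [f lf [_ [s Rs <-] <-]]]; last first.
    apply: subgroupM => //; first exact: linear_sub_semilinear.
    exact: coordwise_semilinear.
  have [fD [s Rs fZ]] := Pf.
  have [cD [_ _ _]] := coordwise_semilinear Rs.
  have cZ := coordwise_semilinearZ Rs.
  exists (f * (coordwise s)^-1)%g; last first.
    by exists (coordwise s); [exists s | rewrite mulgVK].
  split=> [x y|a _ x]; rewrite !symM_apply; first by rewrite (symV_morph cD) fD.
  (* [a *: coordwise s y] is [coordwise s] of [(s^-1 a) *: y], and [f] turns
     [s^-1 a] back into [a]. *)
  rewrite -[x](symVK_apply (coordwise s)); set y := ((coordwise s)^-1)%g x.
  by rewrite -{1}[a](symVK_apply s) -cZ !symV_apply fZ symVK_apply.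
Qed.

(** * The commutant of the linear automorphisms *)

(** The matrix unit at [(i, j)] with entry [a].  The entry multiplies the
    coordinate on the right, as S-linear maps of a left module do. *)
Definition elem_map i a j m : M := (coord m i * a) *: e j.

Lemma elem_mapD i a j : {morph elem_map i a j : x y / x + y}.
Proof. by move=> x y; rewrite /elem_map coordD mulrDl scalerDl. Qed.

Lemma elem_mapZ i a j b m : elem_map i a j (b *: m) = b *: elem_map i a j m.
Proof. by rewrite /elem_map coordZ scalerA mulrA. Qed.

Lemma elem_map_basis i a j : elem_map i a j (e i) = a *: e j.
Proof. by rewrite /elem_map coord_basis eqxx mul1r. Qed.

Lemma elem_map_comp i a j b k m :
  elem_map j b k (elem_map i a j m) = elem_map i (a * b) k m.
Proof. by rewrite /elem_map coordZ coord_basis eqxx mulr1 mulrA. Qed.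

(** Off the diagonal the elementary map squares to zero, so adding the identity
    gives an automorphism. *)
Lemma transvection i a j : j != i ->
  exists2 t, linear_aut M [set: S] t & forall m, t m = m + elem_map i a j m.
Proof.
move=> jNi.
have sq0 m : elem_map i a j (elem_map i a j m) = 0.
  rewrite {1}/elem_map coordZ coord_basis eq_sym (negbTE jNi).
  by rewrite mulr0 mul0r scale0r.
have tbij : bijective (fun m => m + elem_map i a j m).
  exists (fun m => m - elem_map i a j m) => m; rewrite elem_mapD.
    by rewrite sq0 addr0 addrK.
  by rewrite (additiveN (elem_mapD i a j)) sq0 oppr0 addr0 subrK.
exists (Defs.Sym tbij) => //; split=> [x y|b _ x] /=.
  by rewrite elem_mapD addrACA.
by rewrite elem_mapZ scalerDr.
Qed.

(** The hypothesis [forall j, j = i] says that the rank is one, so [M] is a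
    copy of [S] and its linear automorphisms are the right multiplications by
    units. *)
Lemma right_unit_mult i u : (forall j, j = i) -> invertible u ->
  exists2 t, linear_aut M [set: S] t & forall m, t m = elem_map i u i m.
Proof.
move=> only_i [v [uv vu]].
have elem1 m : elem_map i 1 i m = m.
  rewrite -[RHS]coordK /lincomb (bigD1 i) //= big1 ?addr0 => [|j].
    by rewrite /elem_map mulr1.
  by rewrite (only_i j) eqxx.
have tbij : bijective (elem_map i u i).
  by exists (elem_map i v i) => m; rewrite elem_map_comp ?uv ?vu elem1.
exists (Defs.Sym tbij) => //; split=> [|b _ x] /=; first exact: elem_mapD.
exact: elem_mapZ.
Qed.

Section Commutant.
Hypothesis S_gen : additively_generated_by_units S.
Variable phi : M -> M.
Hypothesis phiD : {morph phi : x y / x + y}.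
Hypothesis phiC :
  forall t, linear_aut M [set: S] t -> forall m, phi (t m) = t (phi m).

Lemma commutes_off_diagonal i a j m : j != i ->
  phi (elem_map i a j m) = elem_map i a j (phi m).
Proof.
move=> jNi; have [t lt tE] := transvection a jNi.
by apply: (@addrI _ (phi m)); rewrite -phiD -!tE phiC.
Qed.

(** On the diagonal, passing through a second index [j] writes the map as a
    composite of two off-diagonal ones.  When there is no second index, the
    entry is decomposed into units. *)
Lemma commutes_elem_map i a j m :
  phi (elem_map i a j m) = elem_map i a j (phi m).
Proof.
have [ji|] := eqVneq j i; last exact: commutes_off_diagonal.
rewrite {j}ji.
have [[j jNi]|all_i] := pselect (exists j, j != i).
  (* The entry [a] is carried from [i] to [j], the entry [1] back to [i]. *)
  rewrite -[a]mulr1 -!(elem_map_comp i a j 1 i).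
  by rewrite !commutes_off_diagonal // eq_sym.
have only_i j : j = i.
  by apply/eqP/negPn/negP=> jNi; apply: all_i; exists j.
have [k [u [c [u_inv ->]]]] := S_gen a.
have elemE x : elem_map i (\sum_(l < k) u l *~ c l) i x
               = \sum_(l < k) elem_map i (u l) i x *~ c l.
  rewrite /elem_map mulr_sumr scaler_suml; apply: eq_bigr => l _.
  by rewrite mulrzAr scalerMzl.
have phiMz x (z : int) : phi (x *~ z) = phi x *~ z.
  have phiMn p : phi (x *+ p) = phi x *+ p.
    by elim: p => [|p IHp]; rewrite ?mulr0n ?additive0 // !mulrS phiD IHp.
  by case: z => p; rewrite ?NegzE ?mulrNz ?additiveN // phiMn.
rewrite !elemE additive_sum //; apply: eq_bigr => l _.
have [t lt tE] := right_unit_mult only_i (u_inv l).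
by rewrite phiMz -!tE phiC.
Qed.

(** The vector [a *: e j] is the image of [e i] under an elementary map, hence
    [phi (a *: e j)] depends only on the [i]-th coordinate [c] of [phi (e i)]:
    it is [(c * a) *: e j]. *)
Lemma commutant_scalar i m : phi m = coord (phi (e i)) i *: m.
Proof.
rewrite -{1}[m]coordK /lincomb additive_sum //.
rewrite -{2}[m]coordK /lincomb scaler_sumr.
apply: eq_bigr => j _.
by rewrite -[in LHS](elem_map_basis i) commutes_elem_map /elem_map scalerA.
Qed.

End Commutant.

(** The conjugate by [h] of the homothety by [a] commutes with [G0], as the
    homothety does and [h] normalizes [G0]; so it is again a homothety, by
    [s a]. *)
Lemma normalizing_twists_scalars (h : symType M) (i : 'I_n) :
  additively_generated_by_units S ->
  {morph h : x y / x + y} ->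
  (forall f, linear_aut M [set: S] f -> linear_aut M [set: S] (f ^ h)%g) ->
  exists s : S -> S, forall a m, h (a *: m) = s a *: h m.
Proof.
move=> S_gen hD hN; pose phi a m := h (a *: (h^-1)%g m).
exists (fun a => coord (phi a (e i)) i) => a m.
rewrite -commutant_scalar //; first by rewrite /phi symV_apply.
  by move=> x y; rewrite /phi (symV_morph hD) scalerDr hD.
move=> t /hN[_ tZ] x; rewrite /phi.
rewrite -[RHS](symVK_apply h); congr (h _).
by rewrite -symJ_apply tZ // symJ_apply symVK_apply.
Qed.

(** The twist of [g] is inverse to the twist of [g^-1], and it fixes [R] because
    [g] is R-linear. *)
Lemma normalizing_semilinear (R : set S) (i : 'I_n) g :
  additively_generated_by_units S ->
  linear_aut M R g ->
  (forall f, linear_aut M [set: S] f -> linear_aut M [set: S] (f ^ g)%g) ->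
  (forall f, linear_aut M [set: S] f -> linear_aut M [set: S] (f ^ g^-1)%g) ->
  semilinear_aut M R g.
Proof.
move=> S_gen [gD gR] gN gVN; split=> //.
have gVD := symV_morph gD.
have [s gs] := normalizing_twists_scalars i S_gen gD gN.
have [t gt] := normalizing_twists_scalars i S_gen gVD gVN.
have sE a : s a *: e i = g (a *: (g^-1)%g (e i)) by rewrite gs symVK_apply.
have tE a : t a *: e i = (g^-1)%g (a *: g (e i)) by rewrite gt symV_apply.
have sbij : bijective s.
  exists t => a; apply: (@scale_basis_inj i) => /=.
    by rewrite tE -gs symV_apply.
  by rewrite sE -gt symVK_apply.
exists (Defs.Sym sbij) => //; split=> /=.
- move=> a b; apply: (@scale_basis_inj i).
  by rewrite /= scalerDl !sE scalerDl gD.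
- split=> [|a b]; apply: (@scale_basis_inj i) => /=.
    by rewrite sE !scale1r symVK_apply.
  by rewrite sE -scalerA gs -sE scalerA.
- by move=> r Rr; apply: (@scale_basis_inj i); rewrite /= sE gR // symVK_apply.
Qed.

End Basis.

(** * The normalizer *)

Theorem theorem3p2 (S : pzRingType) (R : set S)
    (R_subring : GRing.subring_closed [in R])
    (R_central : forall r s : S, R r -> GRing.comm r s)
    (S_gen : additively_generated_by_units S)
    (M : lmodType S) (n : nat) (n_gt0 : (0 < n)%N)
    (M_free : free_of_rank M n)
    (G' : set (symType M)) :
  let G := linear_aut M R in
  let G0 := linear_aut M [set: S] in
  let G0' := G0 `&` G' in
  is_subgroup G' -> G' `<=` G ->
  additively_generates_over R G0' G0 ->
  exists A P : set (symType M),
    [/\ isomorphic_subgroups A (ring_aut_over R),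
        is_semidirect_product P G0 A,
        P `<=` G
      & normalizer G' G0' = P `&` G'].
Proof.
move=> G G0 G0' sgG' G'G genG0.
have [e e_basis] := M_free; pose i0 := Ordinal n_gt0.
have sgG0 : is_subgroup G0 := linear_aut_subgroup M _.
have sgG0' : is_subgroup G0' := subgroupI sgG0 sgG'.
exists (coordwise e_basis @` ring_aut_over R), (semilinear_aut M R); split.
- apply: image_isomorphic (coordwiseM e_basis) _.
  exact: coordwise_inj i0.
- exact: semilinear_semidirect i0.
- exact: semilinear_sub_linear.
apply/seteqP; split=> g [].
  move=> G'g /conj_image_eq[gN gVN]; split=> //.
  have G0'sub : G0' `<=` G0 by move=> x [].
  have gen1 f : G0 f -> additively_generates_over R G0' [set f].
    by move=> G0f _ ->; exact: genG0.
  apply: (normalizing_semilinear e_basis i0) => //; first exact: G'G.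
    by move=> f /gen1; apply: conj_span_linear => //; exact: G'G.
  move=> f /gen1; apply: conj_span_linear => //.
  exact: G'G (subgroupV sgG' G'g).
move=> Pg G'g; split=> //.
have [_ _ /(_ _ Pg)[_ /conj_image_eq[gN gVN]]] := linear_normal_semilinear M R.
apply/conj_image_eq; split=> f [G0f G'f]; split.
- exact: gN.
- exact: subgroupJ.
- exact: gVN.
- by apply: subgroupJ => //; exact: subgroupV.
Qed.
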